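(* A coherent labelling of a polyhedron need not be clockwise coherent or anticlockwise coherent at a vertex: there exist a convex polyhedron $\mathcal{P}$, a coherent labelling of $\mathcal{P}$ and a vertex $v$ of $\mathcal{P}$ such that the labelling is neither clockwise coherent nor anticlockwise coherent at $v$.
   Context: For a convex polyhedron, each face $F$ is oriented by the outward normal, so its boundary edges are traversed anticlockwise as seen from outside. A labelling of all the edges by integers is coherent if, for each face $F$ with $n_F$ edges, there is a choice of starting edge such that the successive labels read anticlockwise from that edge satisfy $a_1<a_2<\cdots<a_{n_F}$. A labelling of the edges by integers is anticlockwise (respectively clockwise) coherent at a vertex $v$ if there is a choice of starting edge at $v$ such that, traversing the edges incident to $v$ once around $v$ in the anticlockwise (respectively clockwise) direction as seen from outside, starting with that edge, the labels are strictly increasing (no condition being imposed from the last edge back to the first). *)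

(* Defs.v *)
From mathcomp Require Import all_boot all_order all_algebra.
From mathcomp Require Import all_classical reals convex.

Set Implicit Arguments.
Unset Strict Implicit.
Unset Printing Implicit Defensive.

Import Order.TTheory GRing.Theory Num.Theory.

Local Open Scope classical_set_scope.
Local Open Scope ring_scope.

Definition dot (R : realType) (u v : 'rV[R]_3) : R := (u *m v^T) 0 0.

(* The scalar triple product u . (v x w), in a right-handed frame. *)
Definition triple (R : realType) (u v w : 'rV[R]_3) : R :=
  \det (\matrix_(i < 3) tnth [tuple u; v; w] i).

Definition conv_hull (R : realType) (A : set 'rV[R]_3) : set 'rV[R]_3 :=
  smallest (@convex_set R 'rV[R]_3) A.

Definition segment (R : realType) (a b : 'rV[R]_3) : set 'rV[R]_3 :=
  conv_hull [set a; b].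

(* A has affine dimension d: p and the p + row i B are d + 1 affinely
   independent points of A, and their affine hull contains A. *)
Definition has_dim (R : realType) (d : nat) (A : set 'rV[R]_3) : Prop :=
  exists (p : 'rV[R]_3) (B : 'M[R]_(d, 3)),
    [/\ row_free B, A p, forall i, A (p + row i B)
      & forall x, A x -> (x - p <= B)%MS].

Definition convex_polyhedron (R : realType) (P : set 'rV[R]_3) : Prop :=
  has_dim 3 P /\ exists s : seq 'rV[R]_3, P = conv_hull [set` s].

(* F is the part of P on which the linear form dot c attains its maximum over
   P.  When P has dimension 3 and F dimension 2, c is nonzero and unique up to
   a positive factor. *)
Definition outward_normal (R : realType) (P F : set 'rV[R]_3)
    (c : 'rV[R]_3) : Prop :=
  exists h : R, (forall x, P x -> dot c x <= h) /\
    F = [set x | P x /\ dot c x = h].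

(* The d-dimensional faces of P, for d < 3 when P has dimension 3: its
   vertices (d = 0, as singletons), edges (d = 1) and faces (d = 2). *)
Definition is_face (R : realType) (d : nat) (P F : set 'rV[R]_3) : Prop :=
  has_dim d F /\ exists c, outward_normal P F c.

Definition is_vertex (R : realType) (P : set 'rV[R]_3) (v : 'rV[R]_3) : Prop :=
  is_face 0 P [set v].

(* Directed from a to b, the edge has F on its left as seen from outside P. *)
Definition anticlockwise_edge (R : realType) (P F : set 'rV[R]_3)
    (a b : 'rV[R]_3) : Prop :=
  [/\ is_face 1 P (segment a b), segment a b `<=` F
    & exists2 c, outward_normal P F c
        & forall x, F x -> 0 <= triple c (b - a) (x - a)].

(* s lists the vertices of F in anticlockwise order; the successive boundary
   edges are the segment v (next s v), for v in s. *)
Definition anticlockwise_boundary (R : realType) (P F : set 'rV[R]_3)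
    (s : seq 'rV[R]_3) : Prop :=
  [/\ uniq s, forall v, v \in s <-> is_vertex P v /\ F v
    & forall v, v \in s -> anticlockwise_edge P F v (next s v)].

(* Only the values of a labelling l at the edges of P, viewed as sets of
   points, are ever used. *)
Definition coherent (R : realType) (P : set 'rV[R]_3)
    (l : set 'rV[R]_3 -> int) : Prop :=
  forall F, is_face 2 P F ->
    exists2 s, anticlockwise_boundary P F s
      & sorted <%R [seq l (segment v (next s v)) | v <- s].

(* The edges from v to a and from v to b bound a common face, and the rotation
   about v from the first to the second, through that face, is anticlockwise as
   seen from outside P. *)
Definition anticlockwise_turn (R : realType) (P : set 'rV[R]_3)
    (v a b : 'rV[R]_3) : Prop :=
  exists F c, [/\ is_face 2 P F, outward_normal P F c,
    segment v a `<=` F, segment v b `<=` F & 0 < triple c (a - v) (b - v)].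

(* s lists, in anticlockwise order around v, the other endpoints of the edges
   incident to v. *)
Definition anticlockwise_around (R : realType) (P : set 'rV[R]_3)
    (v : 'rV[R]_3) (s : seq 'rV[R]_3) : Prop :=
  [/\ uniq s, forall a, a \in s <-> is_face 1 P (segment v a)
    & forall a, a \in s -> anticlockwise_turn P v a (next s a)].

Definition anticlockwise_coherent (R : realType) (P : set 'rV[R]_3)
    (l : set 'rV[R]_3 -> int) (v : 'rV[R]_3) : Prop :=
  exists2 s, anticlockwise_around P v s
    & sorted <%R [seq l (segment v a) | a <- s].

Definition clockwise_coherent (R : realType) (P : set 'rV[R]_3)
    (l : set 'rV[R]_3 -> int) (v : 'rV[R]_3) : Prop :=
  exists2 s, anticlockwise_around P v (rev s)
    & sorted <%R [seq l (segment v a) | a <- s].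

(* Main.v *)
Require Import Defs.
From mathcomp Require Import all_boot all_order all_algebra.
From mathcomp Require Import all_classical reals.
From mathcomp Require Import convex interval_inference ring lra zify.

(** The polyhedron is the triangular bipyramid with equator 0, 1, 2 and
    apexes 3, 4.  Its facets, listed with their edges in anticlockwise order,
    are labelled as follows:
      - 0 1 3 : 01 = 0, 13 = 2, 30 = 4      - 1 0 4 : 10 = 0, 04 = 5, 41 = 7
      - 3 1 2 : 31 = 2, 12 = 6, 23 = 8      - 4 2 1 : 42 = 3, 21 = 6, 14 = 7
      - 2 0 3 : 20 = 1, 03 = 4, 32 = 8      - 0 2 4 : 02 = 1, 24 = 3, 40 = 5
    so the labelling is coherent.  The neighbours of the equatorial vertex 0
    are, in anticlockwise order, 1, 3, 2, 4, and the labels of the edges to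
    them are 0, 4, 1, 5.  Read cyclically this sequence has two descents and
    two ascents, whereas a labelling that is anticlockwise (clockwise) coherent
    at a vertex has at most one cyclic descent (ascent) there.

    The geometric work is to show that the faces of this convex hull are the
    expected ones.  The part of the convex hull of a set on which a linear form
    attains its maximum is the convex hull of the points of the set that attain
    it ([conv_hull_face]), so every face is spanned by vertices.  The five
    vertices satisfy p0 + p1 + p2 = 0 = p3 + p4; hence if a linear form is
    maximal at both apexes, or at the whole equator, it is maximal at all five
    vertices.  A proper face therefore misses an apex and an equatorial vertex,
    and a face of dimension 2, having at least three vertices, is one of the
    six facets ([facet_classification]).  Conversely each vertex, edge and
    facet is exposed by the sum of the outward normals of the facets that
    contain it ([exposed_outward_normal]).  Coordinates are integers, so that
    what remains is verified by evaluating boolean expressions.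

    The outward normal of a facet is only known up to a positive factor, so
    the direction of a turn around vertex 0 is read off the position of a
    vertex outside the facet ([triple_sign]). *)

Set Implicit Arguments.
Unset Strict Implicit.
Unset Printing Implicit Defensive.

Import Order.TTheory GRing.Theory Num.Theory.

Local Open Scope classical_set_scope.
Local Open Scope ring_scope.

(** * Coordinates, scalar and triple products *)

(** Coordinates indexed by natural numbers, so that distinct expressions of the
    same index become syntactically equal after evaluation. *)
Definition coord (R : realType) (u : 'rV[R]_3) (k : nat) : R := u 0 (inord k).

Lemma coordE (R : realType) (u : 'rV[R]_3) i : u 0 i = coord u i.
Proof. by rewrite /coord inord_val. Qed.

Lemma dotE (R : realType) (u v : 'rV[R]_3) :
  dot u v = coord u 0 * coord v 0 + coord u 1 * coord v 1
            + coord u 2 * coord v 2.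
Proof.
rewrite /dot !mxE !big_ord_recl big_ord0 !mxE !coordE /=; ring.
Qed.

Lemma tripleE (R : realType) (u v w : 'rV[R]_3) :
  triple u v w =
    coord u 0 * (coord v 1 * coord w 2 - coord v 2 * coord w 1)
  + coord u 1 * (coord v 2 * coord w 0 - coord v 0 * coord w 2)
  + coord u 2 * (coord v 0 * coord w 1 - coord v 1 * coord w 0).
Proof.
rewrite /triple (expand_det_row _ ord0) !big_ord_recl big_ord0.
rewrite /cofactor !(expand_det_row _ ord0) !big_ord_recl !big_ord0.
rewrite /cofactor !det_mx11 !mxE !(tnth_nth 0) /= !coordE /= /bump /=.
ring.
Qed.

Lemma coordD (R : realType) (u v : 'rV[R]_3) k :
  coord (u + v) k = coord u k + coord v k.
Proof. by rewrite /coord mxE. Qed.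

Lemma coordB (R : realType) (u v : 'rV[R]_3) k :
  coord (u - v) k = coord u k - coord v k.
Proof. by rewrite /coord !mxE. Qed.

Lemma coordZ (R : realType) (u : 'rV[R]_3) t k :
  coord (t *: u) k = t * coord u k.
Proof. by rewrite /coord !mxE. Qed.

Definition coordL := (coordB, coordD, coordZ).

(** For [c] orthogonal to [u] and [v], the sign of [triple u v w] is the product
    of the signs of [triple c u v] and [dot c w]. *)
Lemma triple_sign (R : realType) (c u v w : 'rV[R]_3) :
  dot c u = 0 -> dot c v = 0 -> dot c w < 0 -> 0 < triple c u v ->
  triple u v w < 0.
Proof.
move=> cu cv cw cuv.
(* Cramer's rule expresses c in terms of the cross products of u, v and w. *)
have E : dot c c * triple u v w =
    dot c u * triple c v w + dot c v * triple c w u + dot c w * triple c u v.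
  by rewrite !dotE !tripleE; ring.
have cc : 0 <= dot c c by rewrite dotE; nra.
have : dot c c * triple u v w < 0.
  by rewrite E cu cv !mul0r !add0r nmulr_rlt0.
by nra.
Qed.

(** * Convex hulls, their faces and dimensions *)

Lemma convex_setI01 (R : realType) (A : set 'rV[R]_3) :
  (forall x y (t : R), 0 < t -> t < 1 -> A x -> A y ->
     A (t *: x + (1 - t) *: y)) -> @convex_set R 'rV[R]_3 A.
Proof.
move=> H; apply/convex_setW => x y; rewrite !inE => Ax Ay k k0 k1; rewrite inE.
exact: H.
Qed.

Lemma convex_conv_hull (R : realType) (A : set 'rV[R]_3) x y (t : R) :
  0 < t -> t < 1 -> conv_hull A x -> conv_hull A y ->
  conv_hull A (t *: x + (1 - t) *: y).
Proof.
move=> t0 t1 Ax Ay D [cD AD].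
have [Dx Dy] : D x /\ D y by split; [apply: Ax|apply: Ay].
have t01 : Itv.spec (@Itv.num_sem R) (Itv.Real `[0%Z, 1%Z]) t.
  by rewrite /= /Itv.num_sem /= num_real in_itv /= !ltW.
have := cD x y (Itv.mk t01); rewrite !inE; exact.
Qed.

Lemma conv_hull_sub (R : realType) (A D : set 'rV[R]_3) :
  (forall x y (t : R), 0 < t -> t < 1 -> D x -> D y ->
     D (t *: x + (1 - t) *: y)) ->
  A `<=` D -> conv_hull A `<=` D.
Proof. by move=> /convex_setI01 cD; apply: smallest_sub. Qed.

Lemma sub_conv_hull (R : realType) (A B : set 'rV[R]_3) :
  A `<=` B -> conv_hull A `<=` conv_hull B.
Proof.
move=> AB; apply: conv_hull_sub; first by move=> *; exact: convex_conv_hull.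
by move=> x /AB; apply: sub_gen_smallest.
Qed.

Lemma dot_conv (R : realType) (c x y : 'rV[R]_3) t :
  dot c (t *: x + (1 - t) *: y) = t * dot c x + (1 - t) * dot c y.
Proof. by rewrite !dotE !coordL; ring. Qed.

Lemma conv_hull_dot_le (R : realType) (A : set 'rV[R]_3) c h :
  (forall x, A x -> dot c x <= h) -> forall x, conv_hull A x -> dot c x <= h.
Proof.
move=> Ah x; move: x; apply: conv_hull_sub => // x y t t0 t1 cx cy.
by rewrite dot_conv; nra.
Qed.

Lemma conv_hull_dot_lt (R : realType) (A : set 'rV[R]_3) c h :
  (forall x, A x -> dot c x < h) -> forall x, conv_hull A x -> dot c x < h.
Proof.
move=> Ah x; move: x; apply: conv_hull_sub => // x y t t0 t1 cx cy.
by rewrite dot_conv; nra.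
Qed.

(** A supporting hyperplane cuts a convex hull along the convex hull of the
    generators that it contains. *)
Lemma conv_hull_face (R : realType) (A : set 'rV[R]_3) c h :
  (forall x, A x -> dot c x <= h) ->
  [set x | conv_hull A x /\ dot c x = h] =
  conv_hull [set x | A x /\ dot c x = h].
Proof.
move=> Ah; apply/seteqP; split=> [x [Ax cx]|].
  (* The points below the hyperplane which, if on it, belong to the smaller
     hull form a convex set. *)
  suff: dot c x <= h /\
     (dot c x = h -> conv_hull [set x | A x /\ dot c x = h] x).
    by case=> _; apply.
  move: x Ax {cx}.
  apply: conv_hull_sub => [x y t t0 t1 [cx Hx] [cy Hy]|x Ax].
    rewrite dot_conv; split; first by nra.
    move=> E; apply: convex_conv_hull => //; [apply: Hx|apply: Hy]; nra.
  by split; [apply: Ah|move=> cx; apply: sub_gen_smallest].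
move=> x Ax; split.
  by apply: sub_conv_hull Ax => y [].
move: x Ax.
apply: conv_hull_sub => [x y t t0 t1 /= cx cy|x []//].
by rewrite dot_conv; nra.
Qed.

Lemma triple_conv (R : realType) (c u a x y : 'rV[R]_3) t :
  triple c u (t *: x + (1 - t) *: y - a) =
  t * triple c u (x - a) + (1 - t) * triple c u (y - a).
Proof. by rewrite !tripleE !coordL; ring. Qed.

Lemma conv_hull_triple_ge0 (R : realType) (A : set 'rV[R]_3) c u a :
  (forall x, A x -> 0 <= triple c u (x - a)) ->
  forall x, conv_hull A x -> 0 <= triple c u (x - a).
Proof.
move=> Ah x; move: x; apply: conv_hull_sub => // x y t t0 t1 cx cy.
by rewrite triple_conv; nra.
Qed.

(** Dimension is monotone, and in particular unique. *)
Lemma has_dim_le (R : realType) d e (A B : set 'rV[R]_3) :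
  A `<=` B -> has_dim d A -> has_dim e B -> (d <= e)%N.
Proof.
move=> AB [p [M [fM Ap AM _]]] [q [N [fN _ _ BN]]].
have : (M <= N)%MS.
  apply/row_subP => i.
  have -> : row i M = (p + row i M - q) - (p - q).
    by rewrite opprB addrA subrK addrC addKr.
  by apply: addmx_sub; rewrite ?eqmx_opp; apply/BN/AB.
move=> /mxrankS; move: fM fN; rewrite /row_free => /eqP -> /eqP -> //.
Qed.

Lemma has_dim_point (R : realType) (v : 'rV[R]_3) : has_dim 0 [set v].
Proof.
exists v, 0; split=> //; first by rewrite /row_free mxrank0.
- by case.
- by move=> x ->; rewrite subrr sub0mx.
Qed.

Lemma has_dim_segment (R : realType) (a b : 'rV[R]_3) :
  a != b -> has_dim 1 (segment a b).
Proof.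
move=> ab; exists a, (b - a); split.
- by rewrite /row_free rank_rV subr_eq0 [b == a]eq_sym ab.
- by apply: sub_gen_smallest; left.
- move=> i; rewrite row_id addrC subrK.
  by apply: sub_gen_smallest; right.
- apply: conv_hull_sub => [x y t t0 t1 ax ay|x [] ->].
  + have -> : t *: x + (1 - t) *: y - a = t *: (x - a) + (1 - t) *: (y - a).
      rewrite !scalerBr addrACA -opprD -scalerDl (_ : t + (1 - t) = 1) ?scale1r//.
      by ring.
    by apply: addmx_sub; apply: scalemx_sub.
  + by rewrite subrr sub0mx.
  + exact: submx_refl.
Qed.

(** * Sequences read cyclically *)

(** If [s] is sorted for [e], the only cyclic step of [s] which can fail [e] is
    the one from the last element back to the first. *)
Lemma descent_last (T : eqType) (e : rel T) (s : seq T) x :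
  sorted e s -> x \in s -> ~~ e x (next s x) -> x = last x s.
Proof.
move=> /sortedP srt xs; rewrite -(nth_last x); rewrite next_nth xs.
case: s srt xs => // z s srt xs nxt.
have ltx : (index x (z :: s) < size (z :: s))%N by rewrite index_mem.
have [lt|ge] := ltnP (index x (z :: s)).+1 (size (z :: s)).
  have := srt x _ lt; rewrite nth_index // => exn.
  case/negP: nxt; move: exn; rewrite [nth _ (z :: s) _]/= (set_nth_default z) //.
have -> : (size (z :: s)).-1 = index x (z :: s).
  by move: ltx ge => /=; lia.
by rewrite nth_index.
Qed.

Lemma next_map_in (T U : eqType) (g : T -> U) (s : seq T) x :
  {in s &, injective g} -> x \in s -> next (map g s) (g x) = g (next s x).
Proof.
move=> gi xs; have idx : index (g x) (map g s) = index x s.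
  elim: s gi xs => //= y s IHs gi; rewrite inE => xys.
  have -> : (g y == g x) = (y == x).
    apply/eqP/eqP => [|-> //]; apply: gi; by rewrite inE ?eqxx.
  case: eqP => // yx; congr S; apply: IHs.
    by move=> a b sa sb; apply: gi; rewrite inE ?sa ?sb orbT.
  by case/orP: xys => // /eqP xy; case: yx.
rewrite !next_nth map_f // xs idx; case: s {gi idx} xs => //= y s xs.
case: (ltnP (index x (y :: s)) (size s)) => [lt|ge]; first by rewrite (nth_map y).
by rewrite !nth_default ?size_map.
Qed.

(** * Integer coordinates *)

(** Vectors with integer coordinates are represented by triples of integers,
    on which the operations below compute. *)
Notation int3 := (int * int * int)%type.

Definition ivec (R : realType) (x : int3) : 'rV[R]_3 :=
  \row_j (nth 0 [:: x.1.1; x.1.2; x.2] j)%:~R.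

Definition idot (x y : int3) : int :=
  x.1.1 * y.1.1 + x.1.2 * y.1.2 + x.2 * y.2.

Definition itriple (x y z : int3) : int :=
  x.1.1 * (y.1.2 * z.2 - y.2 * z.1.2) + x.1.2 * (y.2 * z.1.1 - y.1.1 * z.2)
  + x.2 * (y.1.1 * z.1.2 - y.1.2 * z.1.1).

Definition add3 (x y : int3) : int3 :=
  (x.1.1 + y.1.1, x.1.2 + y.1.2, x.2 + y.2).
Definition sub3 (x y : int3) : int3 :=
  (x.1.1 - y.1.1, x.1.2 - y.1.2, x.2 - y.2).

Lemma coord_ivec (R : realType) x :
  (coord (ivec R x) 0 = x.1.1%:~R) * (coord (ivec R x) 1 = x.1.2%:~R) *
  (coord (ivec R x) 2 = x.2%:~R).
Proof. by rewrite /coord !mxE !inordK. Qed.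

Lemma ivecB (R : realType) x y : ivec R x - ivec R y = ivec R (sub3 x y).
Proof.
by apply/rowP => -[[|[|[|//]]] ?]; rewrite !mxE /= intrB.
Qed.

Lemma idotE (R : realType) x y : dot (ivec R x) (ivec R y) = (idot x y)%:~R.
Proof. by rewrite dotE !coord_ivec !(rmorphD, rmorphM). Qed.

Lemma itripleE (R : realType) x y z :
  triple (ivec R x) (ivec R y) (ivec R z) = (itriple x y z)%:~R.
Proof. by rewrite tripleE !coord_ivec !(rmorphD, rmorphM, rmorphN). Qed.

(** * The triangular bipyramid *)

(** Vertices [0], [1], [2] form the equator, [3] and [4] are the apexes. *)
Definition vtx (i : nat) : int3 :=
  nth (0, 0, 0) [:: (1, 0, 0); (0, 1, 0); (-1, -1, 0); (0, 0, 1); (0, 0, -1)] i.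

Definition pt (R : realType) (i : nat) : 'rV[R]_3 := ivec R (vtx i).

(** The convex hull of the vertices whose indices are listed in [t]. *)
Definition hull (R : realType) (t : seq nat) : set 'rV[R]_3 :=
  conv_hull [set` [seq pt R i | i <- t]].
Arguments hull : clear implicits.

Definition bipyramid (R : realType) : set 'rV[R]_3 := hull R (iota 0 5).
Arguments bipyramid : clear implicits.

(** The facets, with outward normals.  The vertices of each facet are listed
    anticlockwise from the starting vertex for which the successive edge labels
    increase. *)
Definition facets : seq (seq nat * int3) :=
  [:: ([:: 0; 1; 3]%N, (1, 1, 1)); ([:: 3; 1; 2]%N, (-2, 1, 1));
      ([:: 2; 0; 3]%N, (1, -2, 1)); ([:: 1; 0; 4]%N, (1, 1, -1));
      ([:: 4; 2; 1]%N, (-2, 1, -1)); ([:: 0; 2; 4]%N, (1, -2, -1))].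

Definition facets_at (t : seq nat) := [seq f <- facets | all (mem f.1) t].

(** The sum of the outward normals of the facets that contain [t].  Each of
    those normals takes the value [1] on its facet and smaller values at the
    other vertices. *)
Definition normal (t : seq nat) : int3 :=
  foldr add3 (0, 0, 0) [seq f.2 | f <- facets_at t].

(** Among the five vertices, the linear form [normal t] attains its maximum
    exactly on [t], and this maximum is the number of facets that contain [t]. *)
Definition exposed (t : seq nat) : bool :=
  all (gtn 5) t &&
  all (fun i => if i \in t then idot (normal t) (vtx i) == size (facets_at t)
                else idot (normal t) (vtx i) < size (facets_at t)) (iota 0 5).

Lemma exposed_vertices : all (fun i => exposed [:: i]) (iota 0 5).
Proof. by []. Qed.

Lemma exposed_facets : all (fun f => exposed f.1) facets.
Proof. by []. Qed.

Lemma exposed_edges :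
  all (fun f => all (fun i => exposed [:: i; next f.1 i]) f.1) facets.
Proof. by []. Qed.

Lemma sub_pts (R : realType) (t : seq nat) (D : set 'rV[R]_3) :
  (forall i, i \in t -> D (pt R i)) -> [set` [seq pt R i | i <- t]] `<=` D.
Proof. by move=> Dt x /= /mapP[i it ->]; apply: Dt. Qed.

Lemma sub_hull (R : realType) (t u : seq nat) :
  {subset t <= u} -> hull R t `<=` hull R u.
Proof.
move=> tu; apply: sub_conv_hull; apply: sub_pts => i /tu iu.
by apply/mapP; exists i.
Qed.

Lemma mem_hull (R : realType) (t : seq nat) i : i \in t -> hull R t (pt R i).
Proof. by move=> it; apply: sub_gen_smallest; apply/mapP; exists i. Qed.

Lemma hull_face (R : realType) (t : seq nat) c h :
  (forall i, i \in t -> dot c (pt R i) <= h) ->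
  [set x | hull R t x /\ dot c x = h] =
  hull R [seq i <- t | dot c (pt R i) == h].
Proof.
move=> th; rewrite conv_hull_face; last by apply: sub_pts.
congr conv_hull; apply/seteqP; split=> x /=.
  move=> [/mapP[i it ->] ch]; apply/mapP; exists i => //.
  by rewrite mem_filter ch eqxx.
move=> /mapP[i]; rewrite mem_filter => /andP[/eqP ci it] ->; split=> //.
by apply/mapP; exists i.
Qed.

Lemma segment_hull (R : realType) i j :
  segment (pt R i) (pt R j) = hull R [:: i; j].
Proof.
congr conv_hull; apply/seteqP; split=> x /=.
  by case=> ->; rewrite !inE eqxx ?orbT.
by rewrite !inE => /orP[] /eqP ->; [left|right].
Qed.

Lemma exposed_outward_normal (R : realType) (t : seq nat) : exposed t ->
  outward_normal (bipyramid R) (hull R t) (ivec R (normal t)).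
Proof.
move=> /andP[/allP t5 /allP ex].
have le i : i \in iota 0 5 ->
    dot (ivec R (normal t)) (pt R i) <= (size (facets_at t))%:~R.
  move=> /ex; rewrite idotE ler_int; case: ifP => _; [by move=> /eqP->|exact: ltW].
exists (size (facets_at t))%:~R; split.
  by apply: conv_hull_dot_le; apply: sub_pts.
rewrite /bipyramid hull_face //.
have E : [seq i <- iota 0 5 | dot (ivec R (normal t)) (pt R i) ==
             (size (facets_at t))%:~R] =i t.
  move=> i; rewrite mem_filter; apply/andP/idP => [[/eqP]|it].
    rewrite idotE => /intr_inj E /ex; rewrite E; case: ifP => // _.
    by rewrite ltxx.
  have i5 : i \in iota 0 5 by rewrite mem_iota; apply: (t5 i it).
  by split=> //; have := ex _ i5; rewrite it idotE => /eqP ->.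
by apply/seteqP; split; apply: sub_hull => i; rewrite E.
Qed.

(** Every vertex is an extreme point of the bipyramid. *)
Lemma hull_mem (R : realType) (t : seq nat) i :
  (i < 5)%N -> {subset t <= iota 0 5} -> hull R t (pt R i) -> i \in t.
Proof.
move=> i5 t5 hi; apply/negPn/negP => nit.
have i5' : i \in iota 0 5 by rewrite mem_iota.
have /allP/(_ _ i5')/andP[_ /allP ex] := exposed_vertices.
pose c := ivec R (normal [:: i]).
have : dot c (pt R i) < dot c (pt R i).
  apply: conv_hull_dot_lt hi; apply: sub_pts => j jt.
  have := ex _ i5'; rewrite inE eqxx !idotE ltr_int => /eqP ->.
  have := ex _ (t5 _ jt); rewrite inE; case: eqP => // ji.
  by rewrite -ji jt in nit.
by rewrite ltxx.
Qed.

Lemma pt_inj (R : realType) i j : (i < 5)%N -> (j < 5)%N ->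
  pt R i = pt R j -> i = j.
Proof.
move=> i5 j5 E; suff: i \in [:: j] by rewrite inE => /eqP.
apply: (@hull_mem R) => //; last by rewrite E; apply: mem_hull; rewrite inE.
by move=> k; rewrite inE => /eqP ->; rewrite mem_iota.
Qed.

Lemma exposed_lt5 t : exposed t -> {subset t <= iota 0 5}.
Proof. by move=> /andP[/allP t5 _] i /t5; rewrite mem_iota. Qed.

Lemma hull1 (R : realType) i : hull R [:: i] = [set pt R i].
Proof.
apply/seteqP; split=> [|x ->]; last by apply: mem_hull; rewrite inE.
apply: conv_hull_sub => [x y t _ _ -> ->|].
  by rewrite -scalerDl (_ : t + (1 - t) = 1) ?scale1r //; ring.
by apply: sub_pts => j; rewrite inE => /eqP ->.
Qed.

Lemma is_vertex_pt (R : realType) (i : nat) :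
  (i < 5)%N -> is_vertex (bipyramid R) (pt R i).
Proof.
move=> i5; have i5' : i \in iota 0 5 by rewrite mem_iota.
have /allP/(_ _ i5')/(exposed_outward_normal R) ex := exposed_vertices.
split; first exact: has_dim_point.
by rewrite -hull1; exists (ivec R (normal [:: i])).
Qed.

Lemma vertex_strict (R : realType) i x : (i < 5)%N -> bipyramid R x ->
  x <> pt R i ->
  dot (ivec R (normal [:: i])) x < dot (ivec R (normal [:: i])) (pt R i).
Proof.
move=> i5 Px xi; have i5' : i \in iota 0 5 by rewrite mem_iota.
have /allP/(_ _ i5')/(exposed_outward_normal R)[h [le E]] := exposed_vertices.
have : hull R [:: i] (pt R i) by apply: mem_hull; rewrite inE.
rewrite E => -[_ ->]; rewrite lt_neqAle le // andbT; apply/eqP => cx.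
by have : hull R [:: i] x; [rewrite E|rewrite hull1].
Qed.

Lemma is_edge_exposed (R : realType) (i j : nat) :
  i != j -> exposed [:: i; j] ->
  is_face 1 (bipyramid R) (segment (pt R i) (pt R j)).
Proof.
move=> ij eij; have s5 := exposed_lt5 eij.
split; last by rewrite segment_hull; exists (ivec R (normal [:: i; j]));
  apply: exposed_outward_normal.
have i5 : i \in iota 0 5 by apply: s5; rewrite inE eqxx.
have j5 : j \in iota 0 5 by apply: s5; rewrite !inE eqxx orbT.
move: i5 j5; rewrite !mem_iota => i5 j5.
by apply: has_dim_segment; apply: contraNneq ij => /pt_inj ->.
Qed.

(** * Classification of the faces *)

Lemma outward_normal_hull (R : realType) F c :
  outward_normal (bipyramid R) F c ->
  exists h, (forall i, (i < 5)%N -> dot c (pt R i) <= h) /\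
    F = hull R [seq i <- iota 0 5 | dot c (pt R i) == h].
Proof.
move=> [h [hP ->]]; exists h.
have hi i : (i < 5)%N -> dot c (pt R i) <= h.
  by move=> i5; apply/hP; apply: (@mem_hull R (iota 0 5)); rewrite mem_iota.
split=> //; rewrite /bipyramid hull_face // => i; rewrite mem_iota.
exact: hi.
Qed.

Lemma dim_bipyramid (R : realType) : has_dim 3 (bipyramid R).
Proof.
exists 0, 1%:M; split.
- by rewrite /row_free mxrank1.
- have -> : 0 = 2^-1 *: pt R 3 + (1 - 2^-1) *: pt R 4.
    by apply/rowP => -[[|[|[|//]]] ?]; rewrite !mxE /=; lra.
  by apply: convex_conv_hull; [lra|lra|exact: mem_hull|exact: mem_hull].
- move=> i; rewrite add0r; case: i => -[|[|[|//]]] ?.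
  + rewrite (_ : row _ _ = pt R 0); first exact: mem_hull.
    by apply/rowP => -[[|[|[|//]]] ?]; rewrite !mxE /=.
  + rewrite (_ : row _ _ = pt R 1); first exact: mem_hull.
    by apply/rowP => -[[|[|[|//]]] ?]; rewrite !mxE /=.
  + rewrite (_ : row _ _ = pt R 3); first exact: mem_hull.
    by apply/rowP => -[[|[|[|//]]] ?]; rewrite !mxE /=.
- by move=> x _; rewrite subr0 submx1.
Qed.

Lemma hull_dim_le1 (R : realType) (t : seq nat) i j d :
  i != j -> (i < 5)%N -> (j < 5)%N -> {subset t <= [:: i; j]} ->
  has_dim d (hull R t) -> (d <= 1)%N.
Proof.
move=> ij i5 j5 tij dt.
have : has_dim 1 (segment (pt R i) (pt R j)).
  by apply: has_dim_segment; apply: contraNneq ij => /pt_inj ->.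
by rewrite segment_hull; apply: has_dim_le dt; apply: sub_hull.
Qed.

(** The faces of dimension 2, together with the vertices at which any one of
    their outward normals is maximal. *)
Lemma facet_classification (R : realType) F c :
  has_dim 2 F -> outward_normal (bipyramid R) F c ->
  exists f h, [/\ f \in facets, F = hull R f.1,
    forall i, (i < 5)%N -> dot c (pt R i) <= h &
    forall i, (i < 5)%N -> (dot c (pt R i) == h) = (i \in f.1)].
Proof.
move=> dF /outward_normal_hull[h [le FE]].
pose b i := dot c (pt R i) == h.
(* The affine dependence between the equator and the two apexes. *)
have e1 : dot c (pt R 0) + dot c (pt R 1) + dot c (pt R 2) = 0.
  by rewrite !dotE !coord_ivec /=; ring.
have e2 : dot c (pt R 3) + dot c (pt R 4) = 0.
  by rewrite !dotE !coord_ivec /=; ring.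
have l0 := le 0%N isT; have l1 := le 1%N isT; have l2 := le 2%N isT.
have l3 := le 3%N isT; have l4 := le 4%N isT.
have apexes : b 3 && b 4 ==> [&& b 0, b 1 & b 2].
  apply/implyP => /andP[/eqP b3 /eqP b4].
  by apply/and3P; split; apply/eqP; lra.
have equator : [&& b 0, b 1 & b 2] ==> b 3 && b 4.
  apply/implyP => /and3P[/eqP b0 /eqP b1 /eqP b2].
  by apply/andP; split; apply/eqP; lra.
have proper : ~~ all b (iota 0 5).
  apply/negP => ab; have := has_dim_le (@subset_refl _ _) (dim_bipyramid R).
  by rewrite /bipyramid -(all_filterP ab) -FE => /(_ _ dF).
(* At least three vertices: no two of them contain all the vertices of F. *)
have large : all (fun i => all (fun j =>
    (i == j) || ~~ all (mem [:: i; j]) [seq k <- iota 0 5 | b k])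
    (iota 0 5)) (iota 0 5).
  apply/allP => i; rewrite mem_iota => i5; apply/allP => j; rewrite mem_iota => j5.
  case: eqP => //= /eqP ij; apply/negP => /allP tij.
  by move: dF; rewrite FE => /(hull_dim_le1 ij i5 j5 tij).
have /hasP[f ff /allP bf] :
    has (fun f => all (fun i => b i == (i \in f.1)) (iota 0 5)) facets.
  clearbody b; move: apexes equator proper large => /=.
  by case: (b 0); case: (b 1); case: (b 2); case: (b 3); case: (b 4).
have {}bf i : (i < 5)%N -> b i = (i \in f.1).
  by move=> i5; have := bf i; rewrite mem_iota => /(_ i5)/eqP.
have f5 : {subset f.1 <= iota 0 5}.
  by apply: exposed_lt5; exact: (allP exposed_facets).
exists f, h; split=> //; rewrite FE; apply/seteqP; split; apply: sub_hull => i.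
  by rewrite mem_filter mem_iota => /andP[+ /= i5]; rewrite -/(b i) bf.
move=> fi; have i5 := f5 _ fi; rewrite mem_filter i5 andbT -/(b i) bf //.
by move: i5; rewrite mem_iota.
Qed.

Lemma vertex_bipyramid (R : realType) v : is_vertex (bipyramid R) v ->
  exists2 i, (i < 5)%N & v = pt R i.
Proof.
move=> [_ [c /outward_normal_hull[h [_ E]]]].
case tE: [seq i <- iota 0 5 | dot c (pt R i) == h] => [|i t].
  suff : set0 v by [].
  have : hull R [::] v by rewrite -tE -E.
  by apply: conv_hull_sub => // x.
have it : i \in i :: t by rewrite inE eqxx.
exists i; first by move: (it); rewrite -tE mem_filter mem_iota => /andP[].
by have := @mem_hull R _ _ it; rewrite -tE -E.
Qed.

Lemma edge_endpoint (R : realType) i a : (i < 5)%N ->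
  is_face 1 (bipyramid R) (segment (pt R i) a) ->
  exists j, [/\ (j < 5)%N, j != i & a = pt R j].
Proof.
move=> i5 [d1 [c out]].
have segment_bipyramid x : segment (pt R i) a x -> bipyramid R x.
  by case: out => h [_ ->] [].
have [h [_ E]] := outward_normal_hull out.
have [/hasP[j]|/hasPn ni] :=
    boolP (has (fun j => j != i) [seq k <- iota 0 5 | dot c (pt R k) == h]).
  move=> jt ji; have j5 : (j < 5)%N.
    by move: jt; rewrite mem_filter mem_iota => /andP[].
  (* Otherwise the linear form exposing vertex j would be strictly smaller at
     both ends of the segment than at j, which belongs to it. *)
  exists j; split=> //; apply: contrapT => aj.
  have := @mem_hull R _ _ jt; rewrite -E => sj.
  have : dot (ivec R (normal [:: j])) (pt R j)
         < dot (ivec R (normal [:: j])) (pt R j); last by rewrite ltxx.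
  apply: (conv_hull_dot_lt _ sj) => x [] ->; apply: vertex_strict => //.
  - by apply: segment_bipyramid; apply: sub_gen_smallest; left.
  - by move=> /pt_inj => /(_ i5 j5) ij; rewrite ij eqxx in ji.
  - by apply: segment_bipyramid; apply: sub_gen_smallest; right.
suff : (1 <= 0)%N by [].
apply: has_dim_le d1 (has_dim_point (pt R i)); rewrite E -hull1.
by apply: sub_hull => k /ni; rewrite negbK inE.
Qed.

(** * The coherent labelling *)

(** The label of the edge with endpoints [t], listed in increasing order, is
    its rank in this list. *)
Definition edge_label (t : seq nat) : int :=
  index t [:: [:: 0; 1]; [:: 0; 2]; [:: 1; 3]; [:: 2; 4]; [:: 0; 3]; [:: 0; 4];
              [:: 1; 2]; [:: 1; 4]; [:: 2; 3]]%N.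

(** An edge is recognised by the vertices of the bipyramid that it contains. *)
Definition labelling (R : realType) (E : set 'rV[R]_3) : int :=
  edge_label [seq i <- iota 0 5 | `[< E (pt R i) >]].

Lemma labelling_segment (R : realType) i j : (i < 5)%N -> (j < 5)%N ->
  labelling (segment (pt R i) (pt R j)) =
  edge_label [seq k <- iota 0 5 | k \in [:: i; j]].
Proof.
move=> i5 j5; congr edge_label; apply: eq_in_filter => k.
rewrite mem_iota => k5; rewrite segment_hull; apply/asboolP/idP; last exact: mem_hull.
apply: hull_mem => // l; rewrite inE inE mem_iota.
by case/orP => /eqP ->.
Qed.

Lemma facet_edge (R : realType) f i : f \in facets -> i \in f.1 ->
  anticlockwise_edge (bipyramid R) (hull R f.1)
    (pt R i) (pt R (next f.1 i)).
Proof.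
move=> ff fi; have ef := allP exposed_facets _ ff.
have fj : next f.1 i \in f.1 by rewrite mem_next.
have eij := allP (allP exposed_edges _ ff) _ fi.
have ij : i != next f.1 i.
  apply: (allP (allP (_ : all (fun f => all (fun i => i != next f.1 i) f.1) facets)
    _ ff) _ fi) => //.
split; first exact: is_edge_exposed.
  rewrite segment_hull; apply: sub_hull => k.
  by rewrite !inE => /orP[] /eqP ->.
exists (ivec R (normal f.1)); first exact: exposed_outward_normal.
apply: conv_hull_triple_ge0; apply: sub_pts => k fk.
rewrite !ivecB itripleE ler0z.
have /allP/(_ _ ff)/allP/(_ _ fi)/allP/(_ _ fk) // :
  all (fun f => all (fun i => all (fun k =>
    0 <= itriple (normal f.1) (sub3 (vtx (next f.1 i)) (vtx i))
           (sub3 (vtx k) (vtx i))) f.1) f.1) facets by [].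
Qed.

Lemma facet_boundary (R : realType) f : f \in facets ->
  anticlockwise_boundary (bipyramid R) (hull R f.1) [seq pt R i | i <- f.1].
Proof.
move=> ff; have ef := allP exposed_facets _ ff; have f5 := exposed_lt5 ef.
have lt i : i \in f.1 -> (i < 5)%N by move=> /f5; rewrite mem_iota.
have inj : {in f.1 &, injective (pt R)}.
  by move=> i j /lt i5 /lt j5; apply: pt_inj.
split.
- rewrite map_inj_in_uniq //.
  have /allP/(_ _ ff) // : all (fun f => uniq f.1) facets by [].
- move=> v; split=> [/mapP[i fi ->]|[/vertex_bipyramid[i i5 ->] /hull_mem]].
    by split; [apply/is_vertex_pt/lt|apply: mem_hull].
  by move=> /(_ i5 f5) fi; apply/mapP; exists i.
- by move=> v /mapP[i fi ->]; rewrite next_map_in //; apply: facet_edge.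
Qed.

Lemma coherent_labelling (R : realType) :
  coherent (bipyramid R) (@labelling R).
Proof.
move=> F [dF [c out]].
have [f [h [ff -> _ _]]] := facet_classification dF out.
exists [seq pt R i | i <- f.1]; first exact: facet_boundary.
have f5 i : i \in f.1 -> (i < 5)%N.
  by move/(exposed_lt5 (allP exposed_facets _ ff)); rewrite mem_iota.
rewrite -map_comp (_ : map _ _ = [seq edge_label
    [seq k <- iota 0 5 | k \in [:: i; next f.1 i]] | i <- f.1]).
  have /allP/(_ _ ff) // : all (fun f => sorted <%R [seq edge_label
    [seq k <- iota 0 5 | k \in [:: i; next f.1 i]] | i <- f.1]) facets by [].
apply/eq_in_map => i fi /=; rewrite next_map_in //.
  by rewrite labelling_segment ?f5 ?mem_next.
by move=> a b /f5 a5 /f5 b5; apply: pt_inj.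
Qed.

(** * The labels around vertex 0 *)

(** The neighbour of vertex [0] that follows the neighbour [i] in anticlockwise
    order: [1, 3, 2, 4] cyclically.  The value at [0] is a dummy. *)
Definition turn (i : nat) : nat := nth 0 [:: 0; 3; 4; 2; 1]%N i.

(** Negative when vertex [k] lies on the inner side of the plane through [0],
    [i], [j], for [0], [i], [j] anticlockwise as seen from outside. *)
Definition det0 (i j k : nat) : int :=
  itriple (sub3 (vtx i) (vtx 0)) (sub3 (vtx j) (vtx 0)) (sub3 (vtx k) (vtx 0)).

Lemma turn_at0 (R : realType) i j : (0 < i < 5)%N -> (0 < j < 5)%N ->
  anticlockwise_turn (bipyramid R) (pt R 0) (pt R i) (pt R j) -> j = turn i.
Proof.
move=> i5 j5 [F [c [[dF _] out s0i s0j tr]]].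
have [f [h [ff FE le eqh]]] := facet_classification dF out.
have f5 := exposed_lt5 (allP exposed_facets _ ff).
have inF k : (k < 5)%N -> F (pt R k) -> k \in f.1.
  by move=> k5; rewrite FE; apply: hull_mem.
have f0 : 0%N \in f.1.
  by apply: inF => //; apply: s0i; apply: sub_gen_smallest; left.
have [/andP[i0 i5'] /andP[j0 j5']] := (i5, j5).
have fi : i \in f.1.
  by apply: inF => //; apply: s0i; apply: sub_gen_smallest; right.
have fj : j \in f.1.
  by apply: inF => //; apply: s0j; apply: sub_gen_smallest; right.
have dotB k : dot c (pt R k - pt R 0) = dot c (pt R k) - dot c (pt R 0).
  by rewrite !dotE !coordL; ring.
have c0 : dot c (pt R 0) = h by apply/eqP; rewrite eqh.
have ck k : k \in f.1 -> dot c (pt R k - pt R 0) = 0.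
  move=> fk; have k5 := f5 _ fk; rewrite mem_iota in k5.
  by rewrite dotB c0; apply/eqP; rewrite subr_eq0 eqh.
(* The remaining vertices are strictly below the supporting plane of F. *)
have neg k : (k < 5)%N -> k \notin f.1 ->
    det0 i j k < 0.
  move=> k5 fk; rewrite -(ltrz0 R) -itripleE -!ivecB.
  apply: (triple_sign (ck _ fi) (ck _ fj) _ tr).
  by rewrite dotB c0 subr_lt0 lt_neqAle le // eqh // fk.
have : all (fun k => (k \in f.1) || (det0 i j k < 0)) (iota 0 5).
  apply/allP => k; rewrite mem_iota => k5.
  by case: (boolP (k \in f.1)) => //; apply: neg.
have : all (fun f => all (fun i => all (fun j =>
    [&& (0 < i)%N, (0 < j)%N, 0%N \in f.1
      & all (fun k => (k \in f.1) || (det0 i j k < 0)) (iota 0 5)]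
    ==> (j == turn i)) f.1) f.1) facets by [].
move=> /allP/(_ _ ff)/allP/(_ _ fi)/allP/(_ _ fj)/implyP H K.
by apply/eqP/H; rewrite i0 j0 f0.
Qed.

Lemma edges_at0 (R : realType) (s : seq 'rV[R]_3) :
  (forall a, a \in s <-> is_face 1 (bipyramid R) (segment (pt R 0) a)) ->
  (forall a, a \in s -> exists2 i, (0 < i < 5)%N & a = pt R i) /\
  (forall i, (0 < i < 5)%N -> pt R i \in s).
Proof.
move=> sP; split=> [a /sP /edge_endpoint[//|j [j5 j0 ->]]|i i5].
  by exists j; rewrite ?lt0n ?j0.
apply/sP; apply: is_edge_exposed; first by case/andP: i5; case: i.
have /allP : all (fun i => exposed [:: 0%N; i]) (iota 1 4) by [].
by apply; rewrite mem_iota.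
Qed.

Lemma around_at0 (R : realType) s i :
  anticlockwise_around (bipyramid R) (pt R 0) s -> (0 < i < 5)%N ->
  next s (pt R i) = pt R (turn i).
Proof.
move=> [us /edges_at0[sub nbr] tr] i5.
have [j j5 nj] : exists2 j, (0 < j < 5)%N & next s (pt R i) = pt R j.
  by apply: sub; rewrite mem_next nbr.
by rewrite nj; congr pt; apply: (@turn_at0 R) => //; rewrite -nj; apply/tr/nbr.
Qed.

(** The label of the edge from vertex [0] to its neighbour [i]. *)
Definition spoke (i : nat) : int := edge_label [:: 0%N; i].

(** Two distinct cyclic steps around vertex [0] that fail [e] prevent the labels
    from being sorted for [e], wherever the reading starts. *)
Lemma not_sorted_around (R : realType) (e : rel int) s i j :
  anticlockwise_around (bipyramid R) (pt R 0) s ->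
  (0 < i < 5)%N -> (0 < j < 5)%N -> i != j ->
  ~~ e (spoke i) (spoke (turn i)) -> ~~ e (spoke j) (spoke (turn j)) ->
  ~~ sorted e [seq labelling (segment (pt R 0) a) | a <- s].
Proof.
move=> ar i5 j5 ij ei ej; apply/negP; rewrite sorted_map => srt.
have [_ /edges_at0[_ nbr] _] := ar.
have spokeE k : (0 < k < 5)%N -> labelling (segment (pt R 0) (pt R k)) = spoke k.
  case/andP=> k0 k5; rewrite labelling_segment //.
  by move: k k0 k5 => [|[|[|[|[|]]]]].
have turn5 k : (0 < k < 5)%N -> (0 < turn k < 5)%N.
  by move: k => [|[|[|[|[|]]]]].
have last k : (0 < k < 5)%N -> ~~ e (spoke k) (spoke (turn k)) ->
    pt R k = last (pt R k) s.
  move=> k5 ek; apply: descent_last srt (nbr _ k5) _.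
  by rewrite (around_at0 ar k5) /= !spokeE // turn5.
have := last _ i5 ei; have := last _ j5 ej; have := nbr _ i5.
case: s {ar srt nbr last} => // a s _ /= <- /pt_inj ij'.
by move: ij; rewrite ij' ?eqxx //; [case/andP: i5|case/andP: j5].
Qed.

Theorem theorem7p5 (R : realType) :
  exists (P : set 'rV[R]_3) (l : set 'rV[R]_3 -> int) (v : 'rV[R]_3),
    [/\ convex_polyhedron P, coherent P l, is_vertex P v,
        ~ clockwise_coherent P l v & ~ anticlockwise_coherent P l v].
Proof.
exists (bipyramid R), (@labelling R), (pt R 0); split.
- by split; [exact: dim_bipyramid|exists [seq pt R i | i <- iota 0 5]].
- exact: coherent_labelling.
- exact: is_vertex_pt.
(* Reversing the sequence turns clockwise coherence into decreasing labels in
   anticlockwise order; the ascents are at neighbours 1 and 2. *)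
- move=> [s ar]; rewrite -(revK s) map_rev rev_sorted => srt.
  by have /negP := not_sorted_around (e := fun x y => y < x) ar
    (isT : 0 < 1 < 5)%N (isT : 0 < 2 < 5)%N isT isT isT.
(* The descents are at neighbours 3 and 4. *)
- move=> [s ar srt].
  by have /negP := not_sorted_around (e := <%R) ar
    (isT : 0 < 3 < 5)%N (isT : 0 < 4 < 5)%N isT isT isT.
Qed.
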